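(* Let $n\ge 4$. Then $E(\mathcal{PSC}_n^{1,0})=\{2t: t\in[1,\lfloor\frac{n-1}{2}\rfloor]\}$.
   Context: For $n\ge 3$, let $C_n$ be the set of $n\times n$ real matrices $A$ whose row $i$ ($1\le i\le n-1$) has a single entry $1$ in column $i+1$ and zeros elsewhere, and whose last row has all entries in $\{0,1\}$. For $A\in C_n$ put $F(A)=A+A^T$. For $\alpha,\mathbf e\in\{0,1\}$ let $C_n^{\alpha,\mathbf e}=\{F(A): A\in C_n,\ a_{n,1}=\alpha,\ a_{n,n}=\mathbf e\}$ and $\mathcal{PSC}_n^{\alpha,\mathbf e}$ the set of primitive matrices in it (primitive: some power is entrywise positive; exponent: least such power). For a set $X$ of matrices, $E(X)$ is the set of exponents of the primitive matrices in $X$. $[a,b]$ denotes the set of integers $k$ with $a\le k\le b$. *)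

(* Defs.v *)
From mathcomp Require Import all_boot all_order all_algebra.
From mathcomp Require Import classical_sets reals.

Set Implicit Arguments.
Unset Strict Implicit.
Unset Printing Implicit Defensive.

Import Order.TTheory GRing.Theory Num.Theory.
Local Open Scope classical_set_scope.
Local Open Scope ring_scope.

(* Indices are 0-based: row (column) i of the usual 1-based numbering is the
   ordinal of value i - 1, so the last row is the i : 'I_n with i.+1 = n. *)

Definition Cmx (R : realType) (n : nat) : set 'M[R]_n :=
  [set A | (forall i j : 'I_n, (i.+1 < n)%N -> A i j = (j == i.+1 :> nat)%:R)
        /\ (forall i j : 'I_n, i.+1 = n -> A i j = 0 \/ A i j = 1)].

Definition symF (R : realType) (n : nat) (A : 'M[R]_n) : 'M[R]_n := A + A^T.

(* C_n^{alpha,e}: alpha and e are the entries a_{n,1} and a_{n,n}, meant to be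
   0 or 1 (for other values the set is empty as soon as 0 < n). *)
Definition SC (R : realType) (n : nat) (alpha e : R) : set 'M[R]_n :=
  [set symF A | A in
    [set A | [/\ Cmx A,
                 forall i j : 'I_n, i.+1 = n -> j = 0 :> nat -> A i j = alpha
               & forall i : 'I_n, i.+1 = n -> A i i = e]]].
Arguments SC {R} n alpha e.

Definition positive_mx (R : realType) (n : nat) (M : 'M[R]_n) : Prop :=
  forall i j : 'I_n, 0 < M i j.

Definition primitive_mx (R : realType) (n : nat) (M : 'M[R]_n) : Prop :=
  exists2 k : nat, (0 < k)%N & positive_mx (M ^+ k).

Definition is_exponent (R : realType) (n : nat) (M : 'M[R]_n) (k : nat) : Prop :=
  [/\ (0 < k)%N, positive_mx (M ^+ k)
    & forall m : nat, (0 < m)%N -> positive_mx (M ^+ m) -> (k <= m)%N].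

Definition PSC (R : realType) (n : nat) (alpha e : R) : set 'M[R]_n :=
  [set M | SC n alpha e M /\ primitive_mx M].
Arguments PSC {R} n alpha e.

Definition exponents (R : realType) (n : nat) (X : set 'M[R]_n) : set nat :=
  [set k | exists M : 'M[R]_n, [/\ X M, primitive_mx M & is_exponent M k]].

(* Main.v *)
Require Import Defs.
From mathcomp Require Import all_boot all_order all_algebra.
From mathcomp Require Import classical_sets reals.
From mathcomp Require Import zify.

Set Implicit Arguments.
Unset Strict Implicit.
Unset Printing Implicit Defensive.

Import Order.TTheory GRing.Theory Num.Theory.

Local Open Scope classical_set_scope.
Local Open Scope ring_scope.

(** The graph of [F(A)] is the path [0, ..., N], with [N = n - 1], together
    with chords that all end at the hub [N]. Edges of the path flip the parity
    of the vertex, so a closed odd walk at [x] visits the hub and splits into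
    an even and an odd walk between [x] and [N]. If all vertices have a closed
    walk of length [2t + 1], then for any [x] and [y] the two even pieces and
    the two odd pieces have total length [4t + 2]; hence one of the two even
    walks from [x] to [y] obtained by joining pieces of equal parity has length
    at most [2t + 1], so at most [2t]. Thus the exponent is even, and it is one
    less than the largest odd girth at a vertex. This girth is at most [n]: if
    [n] is odd the cycle [0, ..., N] passes through all vertices, and if [n] is
    even a chord at an odd vertex cuts it into two odd cycles. The value
    [2t + 1] is attained with chords at [0] and at [2t - 1, ..., N - 1]. *)

Implicit Types (N : nat) (S : pred nat).

(** * Walks of given length in a graph *)

Inductive walk (e : rel nat) : nat -> nat -> nat -> Prop :=
| walk0 x : walk e 0 x x
| walkS k x y z : walk e k x y -> e y z -> walk e k.+1 x z.

Lemma walk1 (e : rel nat) x y : e x y -> walk e 1 x y.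
Proof. exact: walkS (walk0 e x). Qed.

Lemma walk_cat (e : rel nat) k l x y z :
  walk e k x y -> walk e l y z -> walk e (k + l) x z.
Proof.
move=> wxy wyz; elim: wyz wxy => [u|m u v w _ IH evw] wx; first by rewrite addn0.
by rewrite addnS; apply: walkS (IH wx) evw.
Qed.

Lemma walk_sym (e : rel nat) k x y :
  symmetric e -> walk e k x y -> walk e k y x.
Proof.
move=> eC; elim=> [u|m u v w _ IH evw]; first exact: walk0.
by rewrite -add1n; apply: walk_cat IH; apply: walk1; rewrite eC.
Qed.

(** * The path with chords at the hub *)

Definition fan N (S : pred nat) : rel nat := fun x y =>
  [&& (x <= N)%N, (y <= N)%N &
      [|| y == x.+1, x == y.+1, (x == N) && S y | (y == N) && S x]].

Definition all_walks N S k :=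
  forall x y, (x <= N)%N -> (y <= N)%N -> walk (fan N S) k x y.

Lemma fan_sym N S : symmetric (fan N S).
Proof.
move=> x y; rewrite /fan andbCA; congr [&& _, _ & _].
by rewrite orbCA; congr [|| _, _ | _]; rewrite orbC.
Qed.

Lemma fan_hub N S s : S s -> (s <= N)%N -> fan N S N s.
Proof. by move=> Ss sN; rewrite /fan leqnn sN eqxx Ss !orbT. Qed.

Lemma fan_nbr N S x : (0 < N)%N -> (x <= N)%N -> exists2 y, (y <= N)%N & fan N S y x.
Proof.
move=> N0 xN; case: x xN => [|x] xN.
  by exists 1%N; rewrite // /fan N0 !orbT.
by exists x; rewrite ?(ltnW xN) // /fan xN (ltnW xN) eqxx.
Qed.

(** Going back and forth along an edge at the end point adds two steps. *)
Lemma walk_pad N S k l x y : (0 < N)%N -> (y <= N)%N ->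
  walk (fan N S) k x y -> (k <= l)%N -> odd k = odd l -> walk (fan N S) l x y.
Proof.
move=> N0 yN wk kl okl; have [z zN zy] := fan_nbr S N0 yN.
have -> : (l = k + (l - k)./2.*2)%N by lia.
elim: _./2 => [|m IH]; first by rewrite addn0.
by rewrite doubleS !addnS; apply: (walkS (walkS IH _) zy); rewrite fan_sym.
Qed.

Lemma all_walks_leq N S k l :
  (0 < N)%N -> (k <= l)%N -> all_walks N S k -> all_walks N S l.
Proof.
move=> N0 kl wk; rewrite -(subnKC kl); elim: (l - k)%N => [|m IH]; first by rewrite addn0.
move=> x y xN yN; have [z zN zy] := fan_nbr S N0 yN.
by rewrite addnS; apply: walkS zy; apply: IH.
Qed.

Lemma walk_path N S x y : (x <= y)%N -> (y <= N)%N -> walk (fan N S) (y - x) x y.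
Proof.
move=> xy; rewrite -{1 3}(subnKC xy); elim: (y - x)%N => [|m IH] mN.
  by rewrite addn0; exact: walk0.
apply: walkS (IH _) _; first by lia.
rewrite /fan; lia.
Qed.

(** * Odd closed walks and the upper bound *)

(** Edges that avoid the hub join consecutive numbers, so parity can only fail after a visit to the
    hub, where the walk is cut. *)
Lemma walk_parity_or_hub N S k x y : walk (fan N S) k x y ->
  odd k = odd (x + y) \/
  exists a b, [/\ (a + b = k)%N, walk (fan N S) a x N & walk (fan N S) b N y].
Proof.
elim=> [u|m u v w wuv IH evw]; first by left; lia.
case: IH => [par|[a [b [ab wa wb]]]]; last first.
  by right; exists a, b.+1; split=> //; [lia | exact: walkS evw].
have [wN|wN] := eqVneq w N.
  right; exists m.+1, 0%N; split; [lia | rewrite -{2}wN; exact: walkS evw |].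
  by rewrite wN; exact: walk0.
have [vN|vN] := eqVneq v N.
  right; exists m, 1%N; split; [lia | by rewrite -{2}vN | ].
  by rewrite -{2}vN; exact: walk1.
left; move: evw; rewrite /fan; lia.
Qed.

Lemma odd_closed_walk_split N S k x : odd k -> walk (fan N S) k x x ->
  exists a b, [/\ (a + b = k)%N, odd a, ~~ odd b,
                  walk (fan N S) a x N & walk (fan N S) b x N].
Proof.
move=> ok /walk_parity_or_hub[|[a [b [ab wa /(walk_sym (fan_sym N S)) wb]]]].
  by lia.
by have [oa|oa] := boolP (odd a); [exists a, b | exists b, a]; split=> //; lia.
Qed.

Lemma closed_walks_all_walks N S t : (0 < N)%N ->
  (forall x, (x <= N)%N -> walk (fan N S) t.*2.+1 x x) -> all_walks N S t.*2.
Proof.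
move=> N0 cw x y xN yN; have ot : odd t.*2.+1 by lia.
have [a [b [ab oa ob wa wb]]] := odd_closed_walk_split ot (cw x xN).
have [c [d [cd oc od wc wd]]] := odd_closed_walk_split ot (cw y yN).
have symW m u v : walk (fan N S) m u v -> walk (fan N S) m v u
  by exact: walk_sym (fan_sym N S).
have [le_ac|lt_ac] := leqP (a + c) t.*2.
  by apply: (walk_pad N0 yN (walk_cat wa (symW _ _ _ wc))); lia.
by apply: (walk_pad N0 yN (walk_cat wb (symW _ _ _ wd))); lia.
Qed.

(** Climb from [x] to [b], pass through the hub to [a], and climb back to [x]. *)
Lemma walk_cycle N S a b x : (a <= x)%N -> (x <= b)%N -> (b <= N)%N ->
  fan N S b N -> fan N S N a -> walk (fan N S) (b - a).+2 x x.
Proof.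
move=> ax xb bN ebN eNa.
have -> : ((b - a).+2 = (b - x) + 1 + 1 + (x - a))%N by lia.
apply: walk_cat (walk_path S ax (leq_trans xb bN)).
apply: walk_cat (walk1 eNa).
by apply: walk_cat (walk1 ebN); apply: walk_path.
Qed.

Lemma walk_hamilton N S x : S 0%N -> (x <= N)%N -> walk (fan N S) N.+1 x x.
Proof.
move=> S0 xN; have -> : (N.+1 = (N - x) + 1 + x)%N by lia.
have := @walk_path N S 0%N x isT xN; rewrite subn0 => w0x; apply: walk_cat w0x.
have eN0 : fan N S N 0 by exact: fan_hub.
apply: walk_cat (walk1 eN0).
exact: walk_path.
Qed.

Lemma walk_bipartite N S k x y : odd N -> (forall s, S s -> ~~ odd s) ->
  walk (fan N S) k x y -> odd k = odd (x + y).
Proof.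
move=> oN evS; elim=> [u|m u v w _ IH]; first by lia.
move: (evS v) (evS w); rewrite /fan; case: (S v); case: (S w); lia.
Qed.

(** Here [k] is any length witnessing primitivity; for odd [N] it forces a chord at an odd vertex,
    since otherwise the graph would be bipartite. *)
Lemma all_walks_bound N S k : (0 < N)%N -> S 0%N -> (forall s, S s -> (s < N)%N) ->
  all_walks N S k -> all_walks N S (N./2).*2.
Proof.
move=> N0 S0 SN wk; apply: closed_walks_all_walks => // x xN.
have [oN|eN] := boolP (odd N); last first.
  have -> : (N./2.*2 = N)%N by lia.
  exact: (walk_hamilton S0 xN).
have [s [Ss os]] : exists s, S s /\ odd s.
  have [/existsP[s /andP[Ss os]]|nos] := boolP [exists s : 'I_N, S s && odd s].
    by exists s.
  have evS s : S s -> ~~ odd s.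
    move=> Ss; move/existsPn: nos => /(_ (Ordinal (SN s Ss))) /=.
    by rewrite Ss.
  (* Walks of the same length [k] from 0 to 0 and from 0 to 1 would make [k] both even and odd. *)
  have := walk_bipartite oN evS (wk 0%N 0%N isT isT).
  by rewrite (walk_bipartite oN evS (wk 0%N 1%N isT N0)).
have sN := SN s Ss.
have eNs := fan_hub Ss (ltnW sN).
have esN : fan N S s N by rewrite fan_sym.
(* The odd cycles on the two sides of the chord have lengths [s + 2] and [N - s + 1]. Both are at
   most [N], as the odd numbers [s < N] differ by at least 2. *)
have [xs|sx] := leqP x s.
  have eN0 : fan N S N 0 by exact: fan_hub.
  by apply: walk_pad (walk_cycle (leq0n x) xs (ltnW sN) esN eN0) _ _ => //; lia.
have w : walk (fan N S) ((N - x) + 1 + (x - s)) x x.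
  apply: walk_cat (walk_path S (ltnW sx) xN).
  by apply: walk_cat (walk1 eNs); apply: walk_path.
by apply: walk_pad w _ _ => //; lia.
Qed.

Lemma all_walks_pred N S t : (0 < N)%N ->
  all_walks N S t.*2.+1 -> all_walks N S t.*2.
Proof. by move=> N0 w; apply: closed_walks_all_walks => // x xN; apply: w. Qed.

(** * Graphs attaining each even exponent *)

(** The vertices 0 to [2t - 1] and the hub form a cycle of length [2t + 1]; each later vertex
    [x < N] lies on a triangle with [x - 1] and the hub. *)
Definition gap_chords N t : pred nat := fun x =>
  (x == 0%N) || (t.*2.-1 <= x < N)%N.

Lemma gap_all_walks N t : (0 < t)%N -> (t.*2 <= N)%N ->
  all_walks N (gap_chords N t) t.*2.
Proof.
move=> t0 tN; have N0 : (0 < N)%N by lia.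
have S0 : gap_chords N t 0%N by [].
have St x : (t.*2.-1 <= x)%N -> (x < N)%N -> gap_chords N t x.
  by rewrite /gap_chords => -> ->; rewrite orbT.
have eN0 : fan N (gap_chords N t) N 0 by exact: fan_hub.
have hub x : gap_chords N t x -> (x <= N)%N -> fan N (gap_chords N t) x N.
  by rewrite fan_sym; exact: fan_hub.
apply: closed_walks_all_walks => // x xN.
have [x2t|x2t] := ltnP x t.*2.
  have -> : (t.*2.+1 = (t.*2.-1 - 0).+2)%N by lia.
  apply: walk_cycle; [lia | lia | lia | apply: hub; [apply: St|]; lia |].
  exact: fan_hub.
have [xN'|xN'] := ltnP x N.
  apply: (@walk_pad _ _ (x - x.-1).+2) => //; [|lia|lia].
  apply: walk_cycle; [lia | lia | lia | apply: hub; [apply: St|]; lia |].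
  by apply: fan_hub; [apply: St|]; lia.
have -> : x = N by lia.
have -> : (t.*2.+1 = 1 + (t.*2.-1 - 0) + 1)%N by lia.
apply: walk_cat (walk1 (hub t.*2.-1 _ _)); [|apply: St; lia|lia].
by apply: walk_cat (walk1 eN0) (walk_path _ _ _); lia.
Qed.

(* A lower bound for the distance to the hub, equal to [t] at [t - 1]. *)
Definition gap_height N t x : nat :=
  if x == N then 0%N else if (x < t)%N then x.+1 else maxn (t.*2 - x) 1.

Lemma gap_height_lip N t x y : (0 < t)%N -> (t.*2 <= N)%N ->
  fan N (gap_chords N t) x y -> (gap_height N t x <= (gap_height N t y).+1)%N.
Proof.
move=> t0 tN exy; rewrite /gap_height.
by have [xN|xN] := eqVneq x N; have [yN|yN] := eqVneq y N;
  have [xt|xt] := ltnP x t; have [yt|yt] := ltnP y t;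
  move: exy; rewrite /fan /gap_chords; lia.
Qed.

(** A walk from [t - 1] that breaks parity has met the hub, which takes at least [t] steps. Coming
    down to [x] then takes at least the height of [x], since the height changes by at most one along
    an edge. *)
Lemma gap_walk_far N t k x : (0 < t)%N -> (t.*2 <= N)%N ->
  walk (fan N (gap_chords N t)) k t.-1 x ->
  (t <= gap_height N t x + k)%N /\
  (odd k = odd (t.-1 + x) \/ (t + gap_height N t x <= k)%N).
Proof.
have hN : gap_height N t N = 0%N by rewrite /gap_height eqxx.
move=> t0 tN w; move Er: t.-1 w => r w.
elim: w Er => [u|m u v z _ IH evz] Er.
  rewrite /gap_height; case: eqVneq => [?|_]; first by lia.
  have -> : (u < t)%N by lia.
  by split; [lia | left; lia].
have [hv par] := IH Er.
have h1 := gap_height_lip t0 tN evz.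
have h2 : (gap_height N t z <= (gap_height N t v).+1)%N.
  by apply: gap_height_lip => //; rewrite fan_sym.
split; first by lia.
case: par => [par|far]; last by right; lia.
have [zN|zN] := eqVneq z N.
  by right; move: h1; rewrite zN hN; lia.
have [vN|vN] := eqVneq v N.
  by right; move: h2 hv; rewrite vN hN; lia.
by left; move: evz; rewrite /fan; lia.
Qed.

Lemma gap_not_all_walks N t m : (0 < t)%N -> (t.*2 <= N)%N ->
  (m < t.*2)%N -> ~ all_walks N (gap_chords N t) m.
Proof.
move=> t0 tN mt wm.
(* The length [2t - 1] is odd, so a closed walk at [t - 1] breaks parity and needs at least [t + t]
   steps. *)
have w : all_walks N (gap_chords N t) t.*2.-1.
  by apply: all_walks_leq wm; lia.
have rN : (t.-1 <= N)%N by lia.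
have [_] := gap_walk_far t0 tN (w _ _ rN rN).
rewrite /gap_height; case: eqVneq => [?|_]; first by lia.
have -> : (t.-1 < t)%N by lia.
by lia.
Qed.

(** * From matrix powers to walks *)

(** Nonnegative terms cannot cancel, so a sum over intermediate vertices is positive as soon as one
    walk contributes. *)
Lemma expmx_walk (R : realType) n (M : 'M[R]_n) (e : rel nat) k (i j : 'I_n) :
  (forall i j : 'I_n, 0 <= M i j) -> (forall i j : 'I_n, (0 < M i j) = e i j) ->
  (forall x y, e x y -> (x < n)%N) ->
  0 <= (M ^+ k) i j /\ (0 < (M ^+ k) i j <-> walk e k i j).
Proof.
move=> M0 Me en; elim: k j => [|k IH] j.
  rewrite expr0 mxE; split; first exact: ler0n.
  split; first by case: eqVneq => [-> _|_]; [exact: walk0 | rewrite ltxx].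
  move Ek: 0%N => k; move Ei: (i : nat) => x; move Ej: (j : nat) => y w.
  case: w Ek Ei Ej => // z _ <- /val_inj ->; rewrite eqxx; exact: ltr01.
have ge0 l : 0 <= (M ^+ k) i l * M l j by apply: mulr_ge0 => //; have [] := IH l.
rewrite exprSr mxE; split; first by apply: sumr_ge0 => l _.
split=> [|w].
  rewrite lt0r psumr_neq0 // => /andP[/hasP[l _ /= pl] _].
  have [k0 [kw _]] := IH l.
  have kl : 0 < (M ^+ k) i l.
    by rewrite lt0r k0 andbT; apply: contraTneq pl => ->; rewrite mul0r ltxx.
  by apply: walkS (kw kl) _; rewrite -Me -(pmulr_rgt0 _ kl).
inversion w as [|k' x y z wk eyj]; subst.
have [_ [_ wk0]] := IH (Ordinal (en _ _ eyj)).
rewrite (bigD1 (Ordinal (en _ _ eyj))) //= ltr_pwDl ?sumr_ge0 //.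
by rewrite mulr_gt0 ?wk0 // Me.
Qed.

Lemma positive_all_walks (R : realType) N (M : 'M[R]_N.+1) S k :
  (forall i j, 0 <= M i j) -> (forall i j : 'I_N.+1, (0 < M i j) = fan N S i j) ->
  positive_mx (M ^+ k) <-> all_walks N S k.
Proof.
move=> M0 Me.
have W (i j : 'I_N.+1) : 0 < (M ^+ k) i j <-> walk (fan N S) k i j.
  by have [] // := @expmx_walk R N.+1 M (fan N S) k i j M0 Me _ => x y /and3P[].
split=> [pM x y xN yN|aw i j]; last by apply/W; apply: aw; rewrite -ltnS.
by apply/(W (Ordinal (xN : x < N.+1)%N) (Ordinal (yN : y < N.+1)%N)); apply: pM.
Qed.

(** An entry of [symF A] can be 2, for instance where a chord runs along the last path edge; the
    graph records only positivity. *)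
Lemma symF_fan (R : realType) N (A : 'M[R]_N.+1) (S : pred nat) :
  Cmx A -> (forall j : 'I_N.+1, S j = (A ord_max j == 1)) ->
  (forall i j, 0 <= symF A i j) /\
  (forall i j : 'I_N.+1, (0 < symF A i j) = fan N S i j).
Proof.
move=> [Apath Alast] AS.
have AE (i j : 'I_N.+1) : A i j = ((j == i.+1 :> nat) || ((i == N :> nat) && S j))%:R.
  have [iN|iN] := eqVneq (i : nat) N.
    have -> : i = ord_max by apply: val_inj.
    rewrite AS /=; have -> : (j == N.+1 :> nat) = false by have := ltn_ord j; lia.
    by case: (Alast ord_max j erefl) => ->; rewrite ?eqxx // eq_sym oner_eq0.
  by rewrite orbF; apply: Apath; have := ltn_ord i; lia.
split=> i j; rewrite !mxE !AE -natrD; first exact: ler0n.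
have leN (l : 'I_N.+1) : (l <= N)%N by rewrite -ltnS.
rewrite ltr0n /fan !leN /= addn_gt0 !lt0b -!orbA.
by congr orb; rewrite orbCA.
Qed.

Lemma SC_fan (R : realType) N (M : 'M[R]_N.+1) : SC N.+1 1 0 M ->
  exists S : pred nat, [/\ S 0%N, forall s, S s -> (s < N)%N &
    forall k, positive_mx (M ^+ k) <-> all_walks N S k].
Proof.
move=> [A [CA A1 A0] <-].
(* [inord] sends numbers above [N] to 0, where the last row has a 1; the bound [x <= N] keeps them
   out of [S]. *)
pose S : pred nat := fun x => (x <= N)%N && (A ord_max (inord x) == 1).
have AS (j : 'I_N.+1) : S j = (A ord_max j == 1).
  by rewrite /S inord_val -ltnS ltn_ord.
have [M0 Me] := symF_fan CA AS.
exists S; split=> [|s|k]; last exact: positive_all_walks.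
  by rewrite (AS ord0) A1.
rewrite ltn_neqAle => Ss; have sN : (s <= N)%N by case/andP: Ss.
rewrite sN andbT; apply/eqP => sE.
by move: Ss; rewrite sE (AS ord_max) A0 // eq_sym oner_eq0.
Qed.

Lemma gap_SC (R : realType) N t : (0 < t)%N -> (t.*2 <= N)%N ->
  exists2 M : 'M[R]_N.+1, SC N.+1 1 0 M &
    forall k, positive_mx (M ^+ k) <-> all_walks N (gap_chords N t) k.
Proof.
move=> t0 tN.
pose A : 'M[R]_N.+1 := \matrix_(i, j)
  (if i == N :> nat then gap_chords N t j else j == i.+1 :> nat)%:R.
have CA : Cmx A.
  split=> i j; first by move=> iN; rewrite mxE; case: eqVneq => // iE; lia.
  move=> [iN]; rewrite mxE iN eqxx.
  by case: gap_chords; [right | left].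
have AS (j : 'I_N.+1) : gap_chords N t j = (A ord_max j == 1).
  by rewrite mxE eqxx; case: gap_chords; rewrite ?eqxx // eq_sym oner_eq0.
have [M0 Me] := symF_fan CA AS.
exists (symF A); last by move=> k; apply: positive_all_walks.
exists A => //; split=> // [i j [iN] j0|i [iN]]; first by rewrite mxE iN eqxx j0.
have -> : i = ord_max by apply: val_inj.
rewrite mxE eqxx /gap_chords /= ltnn andbF orbF.
by have -> : (N == 0)%N = false by lia.
Qed.

Theorem theorem4 (R : realType) (n : nat) (hn : (4 <= n)%N) :
  exponents (PSC n (1 : R) 0) =
  [set (2 * t)%N | t in [set t : nat | (1 <= t <= (n - 1) %/ 2)%N]].
Proof.
case: n hn => // N hN; have N0 : (0 < N)%N by lia.
apply/seteqP; split=> k /=.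
  move=> [M [[/SC_fan[S [S0 SN MS]] _] _ [k0 /MS wk kmin]]].
  have bound : (k <= N./2.*2)%N.
    by apply: kmin; [lia | apply/MS; apply: all_walks_bound wk].
  have [ok|ek] := boolP (odd k); last first.
    by exists k./2; [apply/andP; split|]; lia.
  have kE : k = k./2.*2.+1 by lia.
  have wk' : all_walks N S k./2.*2 by apply: all_walks_pred; rewrite -?kE.
  (* The exponent 1 is treated apart, because minimality only speaks of positive lengths: it would
     give an empty walk from 0 to 1. *)
  have [k1|k1] := eqVneq k./2 0%N.
    rewrite k1 in wk'; have w := wk' 0%N 1%N isT N0.
    by inversion w.
  have := kmin k./2.*2; rewrite MS => /(_ _ wk'); lia.
move=> [t /andP[t0 tN] <-]; rewrite mul2n.
have {}tN : (t.*2 <= N)%N by lia.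
have [M SCM MS] := gap_SC R t0 tN.
have pos : positive_mx (M ^+ t.*2) by apply/MS; apply: gap_all_walks.
have prim : primitive_mx M by exists t.*2; [lia|].
exists M; split=> //; split=> [|//|m _ /MS wm]; first by lia.
by rewrite leqNgt; apply/negP => mt; apply: gap_not_all_walks wm.
Qed.
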